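(* Let $K$ be a field, let $n \ge 3$ and $3 \le k \le n$ be integers, and let $\Gamma_{n,k} = \mathrm{UT}_n(K)/\gamma_k(\mathrm{UT}_n(K))$. Then $\mathrm{Aut}_c(\Gamma_{n,k}) = \mathrm{Inn}(\Gamma_{n,k})$ if and only if $K$ is a prime field.
   Context: $\mathrm{UT}_n(K)$ is the group of all $n\times n$ lower unitriangular matrices (ones on the diagonal, zeros above it) with entries in $K$. For a group $G$, the lower central series is defined by $\gamma_1(G)=G$ and $\gamma_{j+1}(G)=[\gamma_j(G),G]$ for $j\ge 1$. $\mathrm{Inn}(G)$ is the group of inner automorphisms of $G$. An automorphism $\alpha$ of $G$ is class preserving if $\alpha(x)$ is conjugate to $x$ in $G$ for every $x\in G$; $\mathrm{Aut}_c(G)$ is the group of all class preserving automorphisms of $G$. A prime field is a field with no proper subfield, i.e. (up to isomorphism) $\mathbb{F}_p$ for a prime $p$, or $\mathbb{Q}$. *)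

(* Defs.v *)
From HB Require Import structures.
From mathcomp Require Import all_boot all_order all_algebra.
From mathcomp Require Import boolp classical_sets.

Set Implicit Arguments.
Unset Strict Implicit.
Unset Printing Implicit Defensive.

Import GRing.Theory.

(* Groups are [groupType]s, possibly infinite. Subgroups are boolean predicates;
   the classical axioms of [boolp] make every Prop-valued predicate
   boolean, so quantifying over [{pred G}] is quantifying over all subsets. *)

Section GroupNotions.
Local Open Scope group_scope.
Variable G : groupType.
Implicit Types A B : {pred G}.

Definition generated A : {pred G} :=
  [pred x | `[< forall H : {pred G}, group_closed H -> {subset A <= H} ->
                x \in H >]].

Definition commutators A B : {pred G} :=
  [pred z | `[< exists x y, [/\ x \in A, y \in B & z = [~ x, y]] >]].

(* lower_central 1 = G; the index 0 carries no meaning. *)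
Definition lower_central (j : nat) : {pred G} :=
  iter j.-1 (fun H => generated (commutators H predT)) predT.

Definition conj_closed A := forall x y : G, x \in A -> x ^ y \in A.

Record normal_subgroup := NormalSubgroup {
  normal_pred :> {pred G};
  normal_group_closed : group_closed normal_pred;
  normal_conj_closed : conj_closed normal_pred }.

Lemma generated_group_closed A : group_closed (generated A).
Proof.
split; first by apply/asboolP => H [].
move=> x y /asboolP Hx /asboolP Hy; apply/asboolP => H cH sAH.
by case: (cH) => _; apply; [apply: Hx | apply: Hy].
Qed.

Lemma generated_conj_closed A : conj_closed A -> conj_closed (generated A).
Proof.
move=> cA x y /asboolP Hx; apply/asboolP => H [H1 HF] sAH.
apply: (Hx [pred z | z ^ y \in H]).
  split; first by rewrite inE conj1g.
  by move=> u v; rewrite !inE => Hu Hv; rewrite conjMg conjVg; apply: HF.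
by move=> z Az; rewrite inE; apply/sAH/cA.
Qed.

Lemma commutators_conj_closed A B :
  conj_closed A -> conj_closed B -> conj_closed (commutators A B).
Proof.
move=> cA cB z y /asboolP[a [b [Aa Bb ->]]]; apply/asboolP.
by exists (a ^ y), (b ^ y); split; [apply: cA | apply: cB | apply: conjRg].
Qed.

Lemma lower_central_group_closed j : group_closed (lower_central j).
Proof.
by rewrite /lower_central; case: j.-1 => [//|i]; apply: generated_group_closed.
Qed.

Lemma lower_central_conj_closed j : conj_closed (lower_central j).
Proof.
rewrite /lower_central; elim: j.-1 => [//|i IH] /=.
exact/generated_conj_closed/commutators_conj_closed.
Qed.

Canonical lower_central_normal j :=
  NormalSubgroup (@lower_central_group_closed j) (@lower_central_conj_closed j).

Definition automorphism (f : G -> G) :=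
  bijective f /\ {morph f : x y / x * y}.

Definition class_preserving (f : G -> G) := forall x, exists g, f x = x ^ g.

Definition Autc : set (G -> G) :=
  [set f | automorphism f /\ class_preserving f].

Definition Inn : set (G -> G) := range (fun g x : G => x ^ g).

End GroupNotions.

Arguments Autc : clear implicits.
Arguments Inn : clear implicits.

Section Quotient.
Local Open Scope group_scope.
Local Open Scope quotient_scope.
Variables (G : groupType) (N : normal_subgroup G).

Definition coset_rel (x y : G) := x^-1 * y \in N.

Lemma coset_rel_equiv : equiv_class_of coset_rel.
Proof.
have cN := normal_group_closed N.
split=> [x|x y|y x z]; rewrite /coset_rel.
- by rewrite mulVg; case: cN.
- by apply/idP/idP => /(group_closedV cN); rewrite invgM invgK.
- by move=> /(group_closedM cN) h /h; rewrite mulgA mulgK.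
Qed.

Canonical coset_equiv := EquivRelPack coset_rel_equiv.

Definition quotient_group := {eq_quot coset_equiv}.
HB.instance Definition _ := Choice.on quotient_group.
HB.instance Definition _ := EqQuotient.on quotient_group.

Definition quotient_one : quotient_group := \pi_quotient_group 1.
Definition quotient_mul (u v : quotient_group) : quotient_group :=
  \pi_quotient_group (repr u * repr v).
Definition quotient_inv (u : quotient_group) : quotient_group :=
  \pi_quotient_group ((repr u)^-1).

Lemma coset_reprP (x : G) : coset_rel x (repr (\pi_quotient_group x)).
Proof. by apply/eqmodP; rewrite reprK. Qed.

Lemma pi_quotient_mul (x y : G) :
  quotient_mul (\pi x) (\pi y) = \pi_quotient_group (x * y).
Proof.
have cN := normal_group_closed N.
apply/esym/eqmodP; rewrite /= /coset_rel.
have := coset_reprP x; have := coset_reprP y; rewrite /coset_rel.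
set y' := repr _; set x' := repr _ => Ny Nx.
have -> : (x * y)^-1 * (x' * y') = (x^-1 * x') ^ y * (y^-1 * y').
  by rewrite /conjg invgM !mulgA mulgK.
by apply: group_closedM => //; apply: normal_conj_closed.
Qed.

Lemma pi_quotient_inv (x : G) : quotient_inv (\pi x) = \pi_quotient_group (x^-1).
Proof.
have cN := normal_group_closed N.
apply/esym/eqmodP; rewrite /= /coset_rel invgK.
have := coset_reprP x; rewrite /coset_rel; set x' := repr _ => Nx.
have -> : x * x'^-1 = ((x^-1 * x')^-1) ^ x^-1.
  by rewrite /conjg invgM !invgK !mulgA mulgK.
by apply: normal_conj_closed; apply: group_closedV.
Qed.

Lemma quotient_mulA : associative quotient_mul.
Proof.
elim/quotW=> x; elim/quotW=> y; elim/quotW=> z.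
by rewrite !pi_quotient_mul mulgA.
Qed.

Lemma quotient_mul1 : left_id quotient_one quotient_mul.
Proof. by elim/quotW=> x; rewrite pi_quotient_mul mul1g. Qed.

Lemma quotient_mulr1 : right_id quotient_one quotient_mul.
Proof. by elim/quotW=> x; rewrite pi_quotient_mul mulg1. Qed.

Lemma quotient_mulV : left_inverse quotient_one quotient_inv quotient_mul.
Proof. by elim/quotW=> x; rewrite pi_quotient_inv pi_quotient_mul mulVg. Qed.

Lemma quotient_mulrV : right_inverse quotient_one quotient_inv quotient_mul.
Proof. by elim/quotW=> x; rewrite pi_quotient_inv pi_quotient_mul mulgV. Qed.

HB.instance Definition _ := isGroup.Build quotient_group
  quotient_mulA quotient_mul1 quotient_mulr1 quotient_mulV quotient_mulrV.

End Quotient.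

Section Unitriangular.
Local Open Scope ring_scope.
Variables (K : fieldType) (n : nat).

(* [is_trig_mx] is lower triangularity. *)
Definition unitriangular : {pred 'M[K]_n} :=
  [pred A | is_trig_mx A && [forall i, A i i == 1]].

Record UT := MkUT { UTval :> 'M[K]_n; UTvalP : UTval \in unitriangular }.
HB.instance Definition _ := [isSub for UTval].
HB.instance Definition _ := [Choice of UT by <:].

Lemma unitriangularP (A : 'M[K]_n) :
  reflect (forall i j : 'I_n, (i <= j)%N -> A i j = (i == j)%:R)
          (A \in unitriangular).
Proof.
apply: (iffP andP) => [[/is_trig_mxP A0 /forallP A1] i j|A01].
  rewrite leq_eqVlt => /orP[/eqP/val_inj<-|ltij].
    by rewrite eqxx; apply/eqP/A1.
  by rewrite A0 // -val_eqE ltn_eqF.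
split; first by apply/is_trig_mxP => i j lt; rewrite A01 1?ltnW// -val_eqE ltn_eqF.
by apply/forallP => i; rewrite A01 ?eqxx.
Qed.

Lemma unitriangular1 : 1%:M \in unitriangular.
Proof. by apply/unitriangularP => i j _; rewrite mxE. Qed.

Lemma unitriangularM (A B : 'M[K]_n) :
  A \in unitriangular -> B \in unitriangular -> A *m B \in unitriangular.
Proof.
move=> /unitriangularP hA /unitriangularP hB; apply/unitriangularP => i j leij.
rewrite mxE (bigD1 i) //= hA // eqxx mul1r hB // big1 ?addr0 // => l neq.
have [leil|ltli] := leqP i l; first by rewrite hA // eq_sym (negPf neq) mul0r.
by rewrite hB ?(leq_trans (ltnW ltli)) // -val_eqE ltn_eqF ?mulr0 ?(leq_trans ltli).
Qed.

Lemma unitriangular_unit (A : 'M[K]_n) : A \in unitriangular -> A \in unitmx.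
Proof.
case/andP=> At /forallP A1; rewrite unitmxE det_trig //.
by rewrite big1 ?unitr1 // => i _; apply/eqP.
Qed.

Lemma unitriangularV (A : 'M[K]_n) :
  A \in unitriangular -> invmx A \in unitriangular.
Proof.
move=> hA; have := mulmxV (unitriangular_unit hA); move/unitriangularP: hA => hA.
move: (invmx A) => B /matrixP AB; apply/unitriangularP => i.
have [m] := ubnP (i : nat); elim: m i => // m IH i ltim j leij.
have := AB i j; rewrite !mxE (bigD1 i) //= hA // eqxx mul1r big1 ?addr0 // => l neq.
have [leil|ltli] := leqP i l; first by rewrite hA // eq_sym (negPf neq) mul0r.
rewrite IH ?(leq_trans ltli) ?(leq_trans (ltnW ltli)) // -val_eqE ltn_eqF ?mulr0 //.
exact: leq_trans ltli leij.
Qed.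

Definition UT_one := MkUT unitriangular1.
Definition UT_mul (A B : UT) := MkUT (unitriangularM (UTvalP A) (UTvalP B)).
Definition UT_inv (A : UT) := MkUT (unitriangularV (UTvalP A)).

Lemma UT_mulA : associative UT_mul.
Proof. by move=> A B C; apply/val_inj/mulmxA. Qed.
Lemma UT_mul1 : left_id UT_one UT_mul.
Proof. by move=> A; apply/val_inj/mul1mx. Qed.
Lemma UT_mulr1 : right_id UT_one UT_mul.
Proof. by move=> A; apply/val_inj/mulmx1. Qed.
Lemma UT_mulV : left_inverse UT_one UT_inv UT_mul.
Proof. by move=> A; apply/val_inj/mulVmx/unitriangular_unit/UTvalP. Qed.
Lemma UT_mulrV : right_inverse UT_one UT_inv UT_mul.
Proof. by move=> A; apply/val_inj/mulmxV/unitriangular_unit/UTvalP. Qed.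

HB.instance Definition _ :=
  isGroup.Build UT UT_mulA UT_mul1 UT_mulr1 UT_mulV UT_mulrV.

End Unitriangular.

Definition Gamma (K : fieldType) (n k : nat) : groupType :=
  quotient_group (lower_central_normal (UT K n) k).

Definition prime_field (K : fieldType) :=
  forall F : {pred K}, GRing.divring_closed F -> forall x : K, x \in F.

(* Main.v *)
Require Import Defs.
From HB Require Import structures.
From mathcomp Require Import all_boot all_order all_algebra.
From mathcomp Require Import boolp classical_sets.
From mathcomp Require Import zify ring.

Set Implicit Arguments.
Unset Strict Implicit.
Unset Printing Implicit Defensive.

Import GRing.Theory.
Local Open Scope ring_scope.

(** Two unitriangular matrices are congruent modulo the d-th term of the lower
    central series exactly when they agree at all positions (i, j) with
    i < j + d ([mem_lower_central]), so the quotient is the group of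
    unitriangular matrices truncated at depth k.

    The theorem turns on one property of K: the additive maps from K to K are
    all of the form t |-> t c exactly when K is a prime field
    ([prime_field_linear], [nonprime_field_additive]).

    If K is not prime, take an additive phi that is not of this form, and let
    alpha multiply A by the central transvection whose entry is phi (A a b),
    where (a, b) is the last position of the first subdiagonal in the upper left
    k by k corner. For each A, conjugation by a transvection with a suitable
    entry c adds c * A a b at the same central position, so alpha preserves
    classes ([shear_conj]); but a conjugation that worked for all A at once would
    make phi a multiplication ([shear_not_conj]).

    If K is prime, a class preserving map is corrected one subdiagonal at a time
    ([inner_mod_depth]). Once it is trivial to depth d, its displacement on the
    d-th subdiagonal is a homomorphism to an abelian group ([deviationM]). It is
    therefore determined by the transvections on the first subdiagonal
    ([morph_mod_ext]), and is linear in their parameter because K is prime. The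
    displacement of a transvection is that of a conjugate, so it lives in one row
    and one column. An element g of depth d - 1 realizes prescribed displacements
    of this shape provided that, for each of its entries that is seen by two
    transvections, the two prescribed values agree; testing the map on the product
    of these two transvections shows that they do ([inner_next_layer]). *)

(** * Additive maps of a field *)

Section AdditiveMaps.
Variable K : fieldType.
Implicit Types phi : K -> K.

(** The elements a with phi (a x) = a phi x for all x form a subfield, hence
    everything when there is no proper subfield. *)
Lemma prime_field_linear phi : prime_field K ->
  {morph phi : x y / x + y} -> forall t, phi t = t * phi 1.
Proof.
move=> primeK phiD t.
have phi0 : phi 0 = 0 by have := phiD 0 0; rewrite addr0 -[LHS]addr0 => /addrI.
have phiB x y : phi (x - y) = phi x - phi y.
  by rewrite -[x in RHS](subrK y) (phiD (x - y)) addrK.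
pose F := [pred a : K | `[< forall x, phi (a * x) = a * phi x >]].
suff /primeK/(_ t)/asboolP/(_ 1) : divring_closed F by rewrite mulr1.
split=> [|a b /asboolP ha /asboolP hb|a b /asboolP ha /asboolP hb]; apply/asboolP => x.
- by rewrite !mul1r.
- by rewrite !mulrBl phiB ha hb.
rewrite -!mulrA ha; congr (_ * _).
have [->|b0] := eqVneq b 0; first by rewrite invr0 !mul0r.
by apply: (mulfI b0); rewrite -hb !mulVKf.
Qed.

(** For a proper subfield F and x outside F, the vectors 1 and x are linearly
    independent over F; a maximal F-subspace that contains 1 but not x is a
    hyperplane complementary to F x, and the coordinate along x is an F-linear
    form that vanishes at 1 and equals 1 at x. *)
Lemma nonprime_field_additive : ~ prime_field K ->
  exists phi, {morph phi : x y / x + y} /\ exists x, phi x != x * phi 1.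
Proof.
move=> /existsNP[F] /not_implyP[cF] /existsNP[x xF].
have [F1 FB Fdiv] := cF.
have F0 : 0 \in F by rewrite -(subrr 1) FB.
have FM a b : a \in F -> b \in F -> a * b \in F.
  by move=> Fa Fb; rewrite -[b]invrK Fdiv // -[b^-1]mul1r Fdiv.
have FV a : a \in F -> a^-1 \in F by move=> Fa; rewrite -[a^-1]mul1r Fdiv.
have FD a b : a \in F -> b \in F -> a + b \in F.
  by move=> Fa Fb; rewrite -[b]opprK FB // -[- b]sub0r FB.
(* Subspaces are recorded as unions F `|` S, so that the empty chain also has
   an upper bound. *)
pose U (S : set K) a := a \in F \/ S a.
pose P (S : set K) :=
  ~ U S x /\ forall c a b, c \in F -> U S a -> U S b -> U S (c * a + b).
have [S SP totS|M [[Mx Mlin] maxM]] := @Zorn_bigcup K P.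
  have US X a : S X -> U X a -> U (\bigcup_(Y in S) Y)%classic a.
    by move=> SX [Fa|Xa]; [left|right; exists X].
  split=> [[/xF//|[X SX Xx]]|]; first by have [] := SP X SX; case; right.
  have lin X c a b : S X -> c \in F -> U X a -> U X b ->
      U (\bigcup_(Y in S) Y)%classic (c * a + b).
    by move=> SX Fc Ua Ub; apply: (US X) => //; apply: (SP X SX).2.
  move=> c a b Fc [Fa|[X SX Xa]] [Fb|[Y SY Yb]].
  - by left; rewrite FD ?FM.
  - by apply: (lin Y) => //; [left|right].
  - by apply: (lin X) => //; [right|left].
  have [XY|YX] := totS _ _ SX SY.
    by apply: (lin Y) => //; right=> //; apply: XY.
  by apply: (lin X) => //; right=> //; apply: YX.
have M0 : U M 0 by left.
have MZ c a : c \in F -> U M a -> U M (c * a).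
  by move=> Fc Ma; rewrite -[c * a]addr0; apply: Mlin.
have MB a b : U M a -> U M b -> U M (a - b).
  by move=> Ma Mb; rewrite addrC -mulN1r; apply: Mlin => //; rewrite -sub0r FB.
have MD a b : U M a -> U M b -> U M (a + b).
  by move=> Ma Mb; rewrite -[a]mul1r; apply: Mlin.
(* If y is not in the maximal subspace, adjoining y brings in x; solving for y
   then expresses it modulo that subspace as a multiple of x. *)
have split_x y : exists c, c \in F /\ U M (y - c * x).
  have [My|nMy] := pselect (U M y); first by exists 0; rewrite mul0r subr0.
  pose N := [set z | exists c, c \in F /\ U M (z - c * y)]%classic.
  have UN z : U N z -> N z.
    by case=> // Fz; exists 0; rewrite mul0r subr0; split=> //; left.
  have PN : ~ P N.
    apply: maxM; split=> [z Mz|NM].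
      by exists 0; rewrite mul0r subr0; split=> //; right.
    by apply/nMy; right; apply: NM; exists 1; rewrite mul1r subrr.
  have [c [Fc Mc]] : N x.
    apply: contrapT => nNx; apply: PN.
    split=> [/UN//|c a b Fc /UN[e [Fe Me]] /UN[e' [Fe' Me']]].
    right; exists (c * e + e'); split; first by rewrite FD ?FM.
    have -> : c * a + b - (c * e + e') * y = c * (a - e * y) + (b - e' * y) by ring.
    exact: Mlin.
  have c0 : c != 0 by apply/eqP => c0; apply: Mx; rewrite c0 mul0r subr0 in Mc.
  exists c^-1; split; first exact: FV.
  have -> : y - c^-1 * x = 0 - c^-1 * (x - c * y) by field.
  by apply: MB => //; apply: MZ => //; apply: FV.
have uniq_x y c e : c \in F -> e \in F -> U M (y - c * x) -> U M (y - e * x) -> c = e.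
  move=> Fc Fe Mc Me; apply/eqP; rewrite -subr_eq0; apply/negPn/negP => ce0.
  apply: Mx; have -> : x = (c - e)^-1 * ((y - e * x) - (y - c * x)) by field.
  by apply: MZ; [apply: FV; apply: FB|apply: MB].
have [phi phiP] := choice split_x.
have phiE y c : c \in F -> U M (y - c * x) -> phi y = c.
  by move=> Fc; apply: uniq_x; [case: (phiP y)|by []|case: (phiP y)].
exists phi; split=> [y z|].
  have [[Fy My] [Fz Mz]] := (phiP y, phiP z); apply: phiE; first exact: FD.
  have -> : y + z - (phi y + phi z) * x = (y - phi y * x) + (z - phi z * x) by ring.
  exact: MD.
exists x; rewrite (@phiE x 1) ?(@phiE 1 0) ?mulr0 ?oner_neq0 //.
  by rewrite mul0r subr0; left.
by rewrite mul1r subrr.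
Qed.
End AdditiveMaps.

Ltac ord_neq := by apply/negbTE; rewrite -val_eqE /=; lia.

(** * Unitriangular matrices and depth *)

Section Entries.
Variables (K : fieldType) (n : nat).
Implicit Types (A B g : UT K n) (i j l r s : 'I_n).
Local Notation "A *g B" := (A * B)%g (at level 40, left associativity).

Lemma UTmulE A B i j : (A *g B) i j = \sum_l A i l * B l j.
Proof. by rewrite /= mxE. Qed.

Lemma UT1E i j : (1%g : UT K n) i j = (i == j)%:R.
Proof. by rewrite /= mxE. Qed.

Lemma UTE A i j : (i <= j)%N -> A i j = (i == j)%:R.
Proof. by move: (UTvalP A) => /unitriangularP; apply. Qed.

Lemma UT_ext A B : (forall i j, A i j = B i j) -> A = B.
Proof. by move=> h; apply/val_inj/matrixP. Qed.

Fact mkUT_subproof (F : 'I_n -> 'I_n -> K) :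
  \matrix_(i, j) (if (j < i)%N then F i j else (i == j)%:R)
    \in @unitriangular K n.
Proof. by apply/unitriangularP => i j le; rewrite mxE ltnNge le. Qed.
Definition mkUT F : UT K n := MkUT (mkUT_subproof F).

Lemma mkUTE F i j :
  mkUT F i j = if (j < i)%N then F i j else (i == j)%:R.
Proof. by rewrite /= mxE. Qed.

(** An elementary transvection when s < r; otherwise it degenerates to the
    identity, which is why the lemmas below assume s < r. *)
Definition elem r s (t : K) : UT K n :=
  mkUT (fun i j => (i == r)%:R * (j == s)%:R * t).

Lemma elemE r s t i j : (s < r)%N ->
  elem r s t i j = (i == j)%:R + (i == r)%:R * (j == s)%:R * t.
Proof.
move=> lt; rewrite mkUTE; case: ltnP => [ltji|leij].
  have -> : (i == j) = false by ord_neq.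
  by rewrite add0r.
case: (i =P r) => [ir|_]; case: (j =P s) => [js|_];
  rewrite ?mul0r ?mulr0 ?mul0r ?addr0 //.
by move: leij; rewrite ir js leqNgt lt.
Qed.

Lemma mul_elemr A r s t i j : (s < r)%N ->
  (A *g elem r s t) i j = A i j + (j == s)%:R * (A i r * t).
Proof.
move=> lt; rewrite UTmulE; under eq_bigr do rewrite elemE // mulrDr.
rewrite big_split /= (bigD1 j) //= eqxx mulr1 [X in _ + X + _]big1 ?addr0; last first.
  by move=> l /negPf->; rewrite mulr0.
congr (_ + _); rewrite (bigD1 r) //= eqxx mul1r big1 ?addr0; first by ring.
by move=> l /negPf->; rewrite !mul0r mulr0.
Qed.

Lemma mul_eleml A r s t i j : (s < r)%N ->
  (elem r s t *g A) i j = A i j + (i == r)%:R * (t * A s j).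
Proof.
move=> lt; rewrite UTmulE; under eq_bigr do rewrite elemE // mulrDl.
rewrite big_split /= (bigD1 i) //= eqxx mul1r [X in _ + X + _]big1 ?addr0; last first.
  by move=> l ne; rewrite eq_sym (negPf ne) mul0r.
congr (_ + _); rewrite (bigD1 s) //= eqxx mulr1 big1 ?addr0; first by ring.
by move=> l /negPf->; rewrite mulr0 !mul0r.
Qed.

Lemma elemD r s t u : (s < r)%N -> elem r s (t + u) = elem r s t *g elem r s u.
Proof.
move=> lt; apply: UT_ext => i j; rewrite mul_elemr // !elemE //.
have -> : (r == s) = false by ord_neq.
by case: (i == j); case: (i == r); case: (j == s); rewrite /= ?eqxx; try ring.
Qed.

Lemma elem_commg r l s t u : (s < l < r)%N ->
  elem r s (t * u) = [~ elem r l t, elem l s u]%g.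
Proof.
case/andP=> ltsl ltlr; have ltsr := ltn_trans ltsl ltlr.
apply: (mulgI (elem l s u *g elem r l t)); rewrite -commgC; apply: UT_ext => i j.
rewrite !mul_elemr // !elemE //.
have -> : (r == s) = false by ord_neq.
have -> : (r == l) = false by ord_neq.
rewrite eqxx /=.
by case: (i == r); case: (i == l); case: (j == l); case: (j == s); ring.
Qed.

(** Agreement outside the positions at depth at least d below the diagonal;
    for d >= 1 it is congruence modulo the d-th term of the lower central
    series, by [mem_lower_central]. *)
Definition eq_depth d A B := forall i j, (i < j + d)%N -> A i j = B i j.

Lemma eq_depth_refl d A : eq_depth d A A. Proof. by []. Qed.

Lemma eq_depth_sym d A B : eq_depth d A B -> eq_depth d B A.
Proof. by move=> h i j lt; rewrite h. Qed.

Lemma eq_depth_trans d A B C : eq_depth d A B -> eq_depth d B C -> eq_depth d A C.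
Proof. by move=> h h' i j lt; rewrite h ?h'. Qed.

Lemma eq_depthW d e A B : (d <= e)%N -> eq_depth e A B -> eq_depth d A B.
Proof. by move=> le h i j lt; apply: h; lia. Qed.

Lemma eq_depth1 A B : eq_depth 1 A B.
Proof. by move=> i j lt; rewrite !UTE //; lia. Qed.

Lemma eq_depthM d A A' B B' : eq_depth d A A' -> eq_depth d B B' ->
  eq_depth d (A *g B) (A' *g B').
Proof.
move=> hA hB i j lt; rewrite !UTmulE; apply: eq_bigr => l _.
have [lejl|ltlj] := leqP j l; last first.
  have lj0 : (l == j) = false by ord_neq.
  by rewrite (UTE B) ?(UTE B') ?(ltnW ltlj) // lj0 !mulr0.
have [leli|ltil] := leqP l i; last first.
  have il0 : (i == l) = false by ord_neq.
  by rewrite (UTE A) ?(UTE A') ?(ltnW ltil) // il0 !mul0r.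
by rewrite hA ?hB //; lia.
Qed.

Lemma eq_depthV d A B : eq_depth d A B -> eq_depth d A^-1%g B^-1%g.
Proof.
move=> /eq_depth_sym h.
have := eq_depthM (eq_depthM (@eq_depth_refl d A^-1%g) h) (@eq_depth_refl d B^-1%g).
by rewrite mulgK mulVg mul1g.
Qed.

Lemma eq_depthMl d g A B : eq_depth d (g *g A) (g *g B) <-> eq_depth d A B.
Proof.
split=> [h|]; last exact: eq_depthM.
by have := eq_depthM (@eq_depth_refl d g^-1%g) h; rewrite !mulKg.
Qed.

(** In filtration terms: two matrices congruent at depth d differ on the d-th
    subdiagonal by something central, which multiplication by a unitriangular
    matrix does not change. *)
Lemma eq_depth_subMl d g A B i j : eq_depth d A B -> (i <= j + d)%N ->
  (g *g B) i j - (g *g A) i j = B i j - A i j.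
Proof.
move=> h le; rewrite !UTmulE -sumrB (bigD1 i) //= big1 => [|l ne].
  by rewrite addr0 (UTE g (leqnn _)) eqxx !mul1r.
have [ltli|leil] := ltnP l i; first by rewrite h ?subrr //; lia.
by rewrite (UTE g leil) eq_sym (negPf ne) !mul0r subr0.
Qed.

Lemma eq_depth_subMr d g A B i j : eq_depth d A B -> (i <= j + d)%N ->
  (B *g g) i j - (A *g g) i j = B i j - A i j.
Proof.
move=> h le; rewrite !UTmulE -sumrB (bigD1 j) //= big1 => [|l ne].
  by rewrite addr0 (UTE g (leqnn _)) eqxx !mulr1.
have [ltjl|lelj] := ltnP j l; first by rewrite h ?subrr //; lia.
by rewrite (UTE g lelj) (negPf ne) !mulr0 subr0.
Qed.

Lemma eq_depth_commg d A B : eq_depth d 1%g A -> eq_depth d.+1 1%g [~ A, B]%g.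
Proof.
move=> h; rewrite /commg /conjg.
apply/(eq_depthMl _ A); apply/(eq_depthMl _ B); rewrite mulg1 !mulVKg => i j lt.
have le : (i <= j + d)%N by lia.
have := eq_depth_subMl B h le; rewrite -(eq_depth_subMr B h le) mulg1 mul1g.
by move/addIr.
Qed.

(** The off-diagonal entries of A are cleared one at a time in decreasing
    column order. Right multiplication by [elem r s t] adds t times column r to
    column s; since r > s, column r has already been cleared, so only the entry
    (r, s) changes. *)
Lemma elem_generate_depth (H : {pred UT K n}) d : (0 < d)%N -> group_closed H ->
  (forall r s t, (s + d <= r)%N -> elem r s t \in H) ->
  forall A, eq_depth d 1%g A -> A \in H.
Proof.
move=> d_gt0 cH eH.
(* The number j * n + i orders the positions (i, j) by column, then by row. *)
suff IH m : forall A, eq_depth d 1%g A ->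
    (forall i j, (j < i)%N -> (m <= j * n + i)%N -> A i j = 0) -> A \in H.
  move=> A dA; apply: (IH (n * n)%N) => // i j _.
  have := ltn_ord i; have := ltn_ord j; nia.
elim: m => [|m IH] A dA A0.
  suff -> : A = 1%g by case: cH.
  apply: UT_ext => i j; rewrite UT1E; have [/UTE->//|lt] := leqP i j.
  by rewrite A0 // (_ : i == j = false) //; ord_neq.
have [[r s]|none] := pickP [pred p : 'I_n * 'I_n |
    (p.2 + d <= p.1)%N && (p.2 * n + p.1 == m)%N].
  move=> /= /andP[ledr /eqP em].
  have ltsr : (s < r)%N by lia.
  pose B := A *g elem r s (- A r s).
  have BE i j : B i j = if (i == r) && (j == s) then 0 else A i j.
    rewrite mul_elemr //; case: (j =P s) => [->|_] /=; last by rewrite andbF mul0r addr0.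
    case: (i =P r) => [->|ne] /=; first by rewrite (UTE A (leqnn r)) eqxx /=; ring.
    suff -> : A i r = 0 by ring.
    have [leir|ltri] := leqP i r; first by rewrite UTE //; move/eqP/negPf: ne => ->.
    by apply: A0 => //; nia.
  rewrite -[A](mulgK (elem r s (- A r s))).
  have [_ cdiv] := cH; apply: cdiv; last exact: eH.
  apply: IH => [i j lt|i j ltji lem]; rewrite BE.
    case: andP => [[/eqP ir /eqP js]|_]; last exact: dA.
    by move: lt; rewrite ir js; lia.
  case: andP => // ne; apply: A0 => //.
  rewrite ltn_neqAle lem andbT; apply/eqP => mE; apply: ne.
  have := ltn_ord i; have := ltn_ord r => ltr lti.
  have js : j = s :> nat by nia.
  by split; apply/eqP/val_inj => //=; lia.
apply: IH => // i j ltji; rewrite leq_eqVlt => /orP[/eqP mE|]; last exact: A0.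
rewrite -dA ?UT1E; first by rewrite (_ : i == j = false) //; ord_neq.
by have := none (i, j); rewrite /= -mE eqxx andbT; lia.
Qed.

(** A commutator with an element of depth d has depth d + 1. Conversely each
    transvection at depth at least d + 1 is a commutator of one at depth at
    least d with one on the first subdiagonal, and transvections generate. *)
Lemma mem_lower_central d A : A \in lower_central d.+1 <-> eq_depth d.+1 1%g A.
Proof.
split.
  elim: d A => [|d IH] A; first by move=> _; apply: eq_depth1.
  move=> /asboolP memA.
  have cH : group_closed [pred X : UT K n | `[< eq_depth d.+2 1%g X >]].
    split=> [|X Y /asboolP hX /asboolP hY]; apply/asboolP => //.
    by rewrite -[1%g](mulgV (1 : UT K n)%g); apply: eq_depthM => //; apply: eq_depthV.
  apply/asboolP/(memA _ cH) => _ /asboolP[X [Y [/IH hX _ ->]]].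
  exact/asboolP/eq_depth_commg.
apply: elem_generate_depth => // [|{A}]; first exact: lower_central_group_closed.
elim: d => [//|d IH] r s t le.
have lts : (s.+1 < n)%N by have := ltn_ord r; lia.
have -> : t = t * 1 by rewrite mulr1.
rewrite (@elem_commg r (Ordinal lts)) /=; last by lia.
apply/asboolP => H _; apply; apply/asboolP.
exists (elem r (Ordinal lts) t), (elem (Ordinal lts) s 1); split=> //.
by apply: IH => /=; lia.
Qed.

Lemma eq_depthS d A B : eq_depth d A B ->
  (forall i j, i = (j + d)%N :> nat -> A i j = B i j) -> eq_depth d.+1 A B.
Proof.
move=> h h' i j; rewrite addnS ltnS leq_eqVlt => /orP[/eqP/h'//|]; exact: h.
Qed.

Lemma eq_depthJ d g A B : eq_depth d A B -> eq_depth d (A ^ g)%g (B ^ g)%g.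
Proof. by move=> h; apply: eq_depthM => //; apply: eq_depthM. Qed.

Lemma eq_depth_conj d g A : eq_depth d 1%g g -> eq_depth d.+1 (A ^ g)%g A.
Proof.
move=> /(@eq_depth_commg d g A)/eq_depthV; rewrite invgR invg1 => /eq_depth_sym h.
by have := eq_depthM (@eq_depth_refl d.+1 A) h; rewrite mulg1 /commg mulVKg.
Qed.

(** A conjugate of A that agrees with A to depth d deviates from it, on the
    d-th subdiagonal, by the additive commutator A g - g A, which is linear in
    g. The conjugating g itself may have any depth. *)
Lemma deviation_conj d g A B : eq_depth d A B -> eq_depth d.+1 B (A ^ g)%g ->
  forall i j, (i <= j + d)%N -> B i j - A i j = (A *g g) i j - (g *g A) i j.
Proof.
move=> hAB hB i j le; rewrite -(eq_depth_subMl g hAB le) (conjgC A g).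
by rewrite (eq_depthM (@eq_depth_refl d.+1 g) hB) // addnS.
Qed.

Lemma commutator_elem r s t g i j : (s < r)%N ->
  (elem r s t *g g) i j - (g *g elem r s t) i j =
    (i == r)%:R * (t * g s j) - (j == s)%:R * (g i r * t).
Proof. by move=> lt; rewrite mul_eleml // mul_elemr //; ring. Qed.

(** Endomorphisms of the quotient are handled through lifts to matrices, which
    are multiplicative only up to congruence. *)
Definition morph_mod d (f : UT K n -> UT K n) :=
  forall A B, eq_depth d (f (A *g B)) (f A *g f B).

(** A map that is trivial to depth d moves each element by a central element
    modulo depth d + 1, so this displacement is a homomorphism to the additive
    group. *)
Lemma deviationM d f : morph_mod d.+1 f -> (forall A, eq_depth d A (f A)) ->
  forall A B i j, (i <= j + d)%N ->
  f (A *g B) i j - (A *g B) i j = (f A i j - A i j) + (f B i j - B i j).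
Proof.
move=> fM f_id A B i j le; rewrite fM ?addnS //.
rewrite -(eq_depth_subMl (f A) (f_id B) le) -(eq_depth_subMr B (f_id A) le); ring.
Qed.

(** The displacement of [deviationM] has abelian target, so it kills
    commutators, in particular the transvections of depth at least 2; it is
    therefore determined by its values on the first subdiagonal. *)
Lemma morph_mod_ext d f h : morph_mod d.+1 f -> morph_mod d.+1 h ->
  (forall A, eq_depth d A (f A)) -> (forall A, eq_depth d A (h A)) ->
  (forall r s t, r = s.+1 :> nat -> eq_depth d.+1 (f (elem r s t)) (h (elem r s t))) ->
  forall A, eq_depth d.+1 (f A) (h A).
Proof.
move=> fM hM f_id h_id fh A.
pose D f' A i j : K := (f' A : UT K n) i j - A i j.
pose additive_at f' i j := forall A B, D f' (A *g B) i j = D f' A i j + D f' B i j.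
have fA i j : (i <= j + d)%N -> additive_at f i j.
  by move=> le X Y; rewrite /D (deviationM fM f_id).
have hA i j : (i <= j + d)%N -> additive_at h i j.
  by move=> le X Y; rewrite /D (deviationM hM h_id).
have D1 f' i j : additive_at f' i j -> D f' 1%g i j = 0.
  by move=> /(_ 1%g 1%g); rewrite mulg1 -[LHS]addr0 => /addrI.
have DV f' i j X Y : additive_at f' i j ->
    D f' (X *g Y^-1%g) i j = D f' X i j - D f' Y i j.
  by move=> f'A; rewrite -{2}(mulgVK Y X) (f'A (X *g Y^-1%g) Y) addrK.
have DR f' i j X Y : additive_at f' i j -> D f' [~ X, Y]%g i j = 0.
  move=> f'A; have := f'A (Y *g X) [~ X, Y]%g; rewrite -commgC !f'A [LHS]addrC.
  by rewrite -[LHS]addr0 => /addrI.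
pose H := [pred A | `[< forall i j, (i <= j + d)%N -> D f A i j = D h A i j >]].
have cH : group_closed H.
  split=> [|X Y /asboolP hX /asboolP hY]; apply/asboolP => i j le.
    by rewrite !D1; [|exact: hA|exact: fA].
  by rewrite !DV; [rewrite hX ?hY|exact: hA|exact: fA].
have : A \in H.
  apply: (@elem_generate_depth H 1) => //; last by move=> *; apply: eq_depth1.
  move=> r s t; rewrite addn1 leq_eqVlt => /orP[/eqP rs|lt]; apply/asboolP => i j le.
    by rewrite /D fh ?addnS.
  have lts : (s.+1 < n)%N by have := ltn_ord r; lia.
  have -> : t = t * 1 by rewrite mulr1.
  rewrite (@elem_commg r (Ordinal lts)) /=; last by lia.
  by rewrite !DR; [|exact: hA|exact: fA].
move=> /asboolP AH i j lt; have := AH i j; rewrite /D; move/(_ ltac:(lia)).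
by move/addIr.
Qed.

(** * Class preserving maps over a prime field *)

(** The inductive step of the implication from prime to inner. In this section
    f represents a class preserving endomorphism that is already trivial to
    depth d, and a g of depth d - 1 is found such that conjugation by g agrees
    with f to depth d + 1. *)

Section Layer.
Variables (d : nat) (f : UT K n -> UT K n).
Hypothesis primeK : prime_field K.
Hypothesis d_gt1 : (1 < d)%N.
Hypothesis fM : morph_mod d.+1 f.
Hypothesis fJ : forall A, exists g, eq_depth d.+1 (f A) (A ^ g)%g.
Hypothesis f_id : forall A, eq_depth d A (f A).

Let delta A i j := f A i j - A i j.

(** delta is additive in the parameter t, and primality makes it linear. *)
Let delta_elem r s t i j : (s < r)%N -> (i <= j + d)%N ->
  delta (elem r s t) i j = t * delta (elem r s 1) i j.
Proof.
move=> lt le; apply: (@prime_field_linear _ (fun u => delta (elem r s u) i j)) => // a b.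
by rewrite elemD // /delta (deviationM fM f_id).
Qed.

(** For g of depth d - 1, the entry g i j' would be responsible for both the
   displacement of [elem i' i 1] at (i', j') and, up to sign, that of
   [elem j' j 1] at (i, j). Class preservation at the product of these two
   transvections provides a single conjugating element for both, which forces
   the two prescriptions to be consistent. *)
Let delta_compat i j i' j' :
  i = (j + d)%N :> nat -> i' = i.+1 :> nat -> j' = j.+1 :> nat ->
  delta (elem i' i 1) i' j' = - delta (elem j' j 1) i j.
Proof.
move=> ij ii jj; have [g fg] := fJ (elem i' i 1 *g elem j' j 1).
have h (p q : 'I_n) : (p <= q + d)%N ->
    delta (elem i' i 1) p q + delta (elem j' j 1) p q =
    (p == i')%:R * g i q + (p == j')%:R * g j q
    - (q == i)%:R * g p i' - (q == j)%:R * g p j'.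
  move=> le; rewrite -(deviationM fM f_id) // (deviation_conj (f_id _) fg) //.
  rewrite -mulgA !mul_eleml ?ii ?jj // mulgA !mul_elemr ?ii ?jj //.
  have -> : (i == j') = false by ord_neq.
  have -> : (j' == i) = false by ord_neq.
  by rewrite /=; ring.
(* Conjugation moves a transvection only within its row and its column. *)
have zero (r s p q : 'I_n) : r = s.+1 :> nat -> (p <= q + d)%N -> p != r -> q != s ->
    delta (elem r s 1) p q = 0.
  move=> rs le /negPf pr /negPf qs; have [g' fg'] := fJ (elem r s 1).
  rewrite /delta (deviation_conj (f_id _) fg') // commutator_elem ?rs //.
  by rewrite pr qs !mul0r subrr.
have ne : [/\ i' != j', j' != j, i != i' & j != i].
  by split; rewrite -val_eqE /=; lia.
case: ne => ne1 ne2 ne3 ne4; have ne5 : j' != i by rewrite -val_eqE /=; lia.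
have ne6 : i != j' by rewrite eq_sym.
have := h i' j'; rewrite (zero j' j) // ?ii ?jj; last by lia.
rewrite (negPf ne1) (negPf ne2) (negPf ne5) eqxx addr0 => ->; last by lia.
have := h i j; rewrite (zero i' i) // ?ij //.
rewrite (negPf ne3) (negPf ne4) (negPf ne6) eqxx add0r => -> //.
by rewrite /=; ring.
Qed.

(** A position (p, q) of depth d - 1 sees the displacement of the transvection in
   row p + 1 and that of the one in column q - 1; at the border of the matrix
   only one of them exists. *)
Let conj_entry (p q : 'I_n) : K :=
  if [pick i : 'I_n | i == p.+1 :> nat] is Some i then delta (elem i p 1) i q
  else if [pick j : 'I_n | q == j.+1 :> nat] is Some j
    then - delta (elem q j 1) p j else 0.

Let conjugator : UT K n :=
  mkUT (fun p q : 'I_n => if p.+1 == (q + d)%N then conj_entry p q else 0).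

Let conjugator_depth : eq_depth d.-1 1%g conjugator.
Proof.
move=> p q lt; rewrite UT1E mkUTE; case: ifP => // ltqp.
have -> : (p == q) = false by ord_neq.
by case: ifP => // /eqP; lia.
Qed.

Let conjugatorEl (p q i : 'I_n) : p.+1 = (q + d)%N -> i = p.+1 :> nat ->
  conjugator p q = delta (elem i p 1) i q.
Proof.
move=> pq ip; rewrite mkUTE pq eqxx ifT; last by lia.
rewrite /conj_entry; case: pickP => [i' /eqP ip'|/(_ i)]; last by rewrite ip eqxx.
by have -> : i = i' by apply/val_inj; rewrite /= ip ip'.
Qed.

Let conjugatorEr (p q j : 'I_n) : p.+1 = (q + d)%N -> q = j.+1 :> nat ->
  conjugator p q = - delta (elem q j 1) p j.
Proof.
move=> pq qj; rewrite mkUTE pq eqxx ifT; last by lia.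
rewrite /conj_entry; case: pickP => [i /eqP ip|_].
  by rewrite (@delta_compat p j i q) //; lia.
case: pickP => [j' /eqP qj'|/(_ j)]; last by rewrite qj eqxx.
by have -> : j = j' by apply/val_inj => /=; lia.
Qed.

Lemma inner_next_layer : exists g, forall A, eq_depth d.+1 (f A) (A ^ g)%g.
Proof.
have conj_id A : eq_depth d A (A ^ conjugator)%g.
  have := @eq_depth_conj d.-1 conjugator A conjugator_depth.
  by rewrite prednK; [exact: eq_depth_sym|lia].
exists conjugator; apply: morph_mod_ext => // [A B|r s t rs].
  by rewrite conjMg.
have ltsr : (s < r)%N by lia.
apply: eq_depthS => [|i j ij].
  exact: eq_depth_trans (eq_depth_sym (f_id _)) (conj_id _).
have le : (i <= j + d)%N by lia.
apply: (addIr (- elem r s t i j)).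
rewrite (deviation_conj (conj_id _) (@eq_depth_refl d.+1 _)) //.
rewrite -/(delta _ i j) commutator_elem // delta_elem //.
have [ir|nir] := eqVneq i r.
  move: rs; rewrite -ir => rs; have -> : (j == s) = false by ord_neq.
  by rewrite (@conjugatorEl s j i); [rewrite /=; ring|lia|lia].
have [js|njs] := eqVneq j s.
  move: rs; rewrite -js => rs.
  by rewrite (@conjugatorEr i r j); [rewrite /=; ring|lia|lia].
have [g' fg'] := fJ (elem r s 1).
rewrite /delta (deviation_conj (f_id _) fg') // commutator_elem // (negPf nir) (negPf njs).
by rewrite /=; ring.
Qed.
End Layer.

(** Depth 2 is the abelianization, where class preserving maps are trivial.
    After that, undoing an inner automorphism that is correct to depth d makes
    the map trivial to depth d, and [inner_next_layer] gains one more layer. *)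
Lemma inner_mod_depth d f : prime_field K -> morph_mod d.+1 f ->
  (forall A, exists g, eq_depth d.+1 (f A) (A ^ g)%g) ->
  exists g, forall A, eq_depth d.+1 (f A) (A ^ g)%g.
Proof.
move=> primeK; elim: d f => [|d IH] f fM fJ; first by exists 1%g => A; apply: eq_depth1.
have conj2 A g : eq_depth 2 (A ^ g)%g A by apply/eq_depth_conj/eq_depth1.
case: d IH fM fJ => [|d] IH fM fJ.
  exists 1%g => A; have [g fg] := fJ A; apply: eq_depth_trans fg _.
  by rewrite conjg1; apply: conj2.
have [|A|g fg] := IH f; first by move=> A B; apply: eq_depthW (fM A B).
  by have [g fg] := fJ A; exists g; apply: eq_depthW fg.
pose f' A := (f A ^ g^-1)%g.
have [||||h fh] := @inner_next_layer d.+2 f' primeK.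
- by [].
- by move=> A B; rewrite /f' -conjMg; apply: eq_depthJ; apply: fM.
- by move=> A; have [h fh] := fJ A; exists (h * g^-1)%g; rewrite conjgM; apply: eq_depthJ.
- by move=> A; have := eq_depthJ g^-1%g (fg A); rewrite conjgK; apply: eq_depth_sym.
exists (h * g)%g => A; rewrite conjgM -[f A](conjgKV g); exact: eq_depthJ (fh A).
Qed.

End Entries.

(** * Passage to the quotient *)

Section Quot.
Variables (K : fieldType) (n k : nat).
Implicit Types (A B g : UT K n).
Hypothesis k_gt0 : (0 < k)%N.
Definition proj A : Gamma K n k :=
  (\pi_(quotient_group (lower_central_normal (UT K n) k)) A)%qT.

Lemma projM A B : proj (A * B)%g = (proj A * proj B)%g.
Proof. exact/esym/pi_quotient_mul. Qed.

Lemma proj_repr (u : Gamma K n k) : {A | proj A = u}.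
Proof. by exists (repr u); rewrite /proj reprK. Qed.

Lemma projV A : proj A^-1%g = (proj A)^-1%g.
Proof. exact/esym/pi_quotient_inv. Qed.

Lemma projJ A B : proj (A ^ B)%g = (proj A ^ proj B)%g.
Proof. by rewrite /conjg !projM projV. Qed.

Lemma proj_eq A B : proj A = proj B <-> eq_depth k A B.
Proof.
have -> : eq_depth k A B <-> eq_depth k 1%g (A^-1 * B)%g.
  by rewrite -(mulVg A) eq_depthMl.
have := mem_lower_central k.-1 (A^-1 * B)%g; rewrite prednK // => <-.
by split=> [/eqmodP//|?]; apply/eqmodP.
Qed.

End Quot.

Lemma Inn_sub_Autc (G : groupType) : (Inn G `<=` Autc G)%classic.
Proof.
move=> _ [g _ <-]; split; last by move=> x; exists g.
split; last by move=> x y; apply: conjMg.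
by exists (fun x => x ^ g^-1)%g; [apply: conjgK|apply: conjgKV].
Qed.

Lemma Autc_inner (K : fieldType) (n d : nat) : prime_field K ->
  (Autc (Gamma K n d.+1) `<=` Inn (Gamma K n d.+1))%classic.
Proof.
move=> primeK alpha [[_ alphaM] alphaJ].
pose f A := repr (alpha (proj d.+1 A)) : UT K n.
have fE A : proj d.+1 (f A) = alpha (proj d.+1 A) by rewrite /proj reprK.
have [A B|A|g fg] := @inner_mod_depth K n d f primeK.
- by apply/proj_eq => //; rewrite projM !fE projM alphaM.
- have [u au] := alphaJ (proj d.+1 A); have [g gu] := proj_repr u.
  by exists g; apply/proj_eq => //; rewrite fE projJ au gu.
exists (proj d.+1 g) => //; apply/funext => u; have [A <-] := proj_repr u.
by rewrite -projJ -fE; apply/esym/proj_eq.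
Qed.

(** * A class preserving automorphism that is not inner *)

(** Indices count from 0, so with a = k - 1, b = k - 2 and o = 0 the position
    (a, o) lies on the deepest subdiagonal that survives in the quotient, at
    depth k - 1, and (a, b) lies on the first subdiagonal. *)
Section CentralShear.
Variables (K : fieldType) (n k : nat) (a b o : 'I_n).
Hypotheses (ak : k = a.+1 :> nat) (ab : a = b.+1 :> nat) (o0 : o = 0%N :> nat)
  (b_gt0 : (0 < b)%N).
Implicit Types (A B g : UT K n) (phi : K -> K).
Local Notation "A *g B" := (A * B)%g (at level 40, left associativity).

Definition shear phi A := A *g elem a o (phi (A a b)).

Let ltoa : (o < a)%N. Proof. lia. Qed.
Let ltob : (o < b)%N. Proof. lia. Qed.
Let ltba : (b < a)%N. Proof. lia. Qed.

Lemma shear_eq_depth phi A B : eq_depth k A B -> eq_depth k (shear phi A) (shear phi B).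
Proof. by move=> AB; rewrite /shear (AB a b); [exact: eq_depthM|lia]. Qed.

Lemma shearE phi A i j :
  shear phi A i j = A i j + (j == o)%:R * (A i a * phi (A a b)).
Proof. by rewrite mul_elemr. Qed.

Lemma shear_ab phi A : shear phi A a b = A a b.
Proof. by rewrite shearE (_ : b == o = false) ?mul0r ?addr0 //; ord_neq. Qed.

Lemma shearK phi psi : (forall t, psi t = - phi t) -> cancel (shear phi) (shear psi).
Proof.
move=> psiE A; rewrite {1}/shear shear_ab psiE /shear -mulgA -elemD // subrr.
apply: UT_ext => i j; rewrite mul_elemr //; ring.
Qed.

(** The entry (a, b) is a homomorphism to the additive group, and transvections
    at (a, o) are central modulo depth k. *)
Lemma shearM phi A B : {morph phi : x y / x + y} ->
  eq_depth k (shear phi (A *g B)) (shear phi A *g shear phi B).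
Proof.
move=> phiD; rewrite /shear.
have -> : (A *g B) a b = A a b + B a b.
  have le : (a <= b + 1)%N by lia.
  have := eq_depth_subMr B (eq_depth1 1%g A) le; rewrite mul1g UT1E.
  have -> : (a == b) = false by ord_neq.
  by move/eqP; rewrite subr_eq subr0 => /eqP.
rewrite phiD elemD // mulgA -!mulgA; apply: eq_depthM => //.
rewrite !mulgA; apply: eq_depthM => //.
move=> i j lt; rewrite mul_elemr // mul_eleml //; congr (_ + _).
have [jo|nj] := eqVneq j o; last first.
  have oj : (o == j) = false by rewrite eq_sym (negPf nj).
  by rewrite (UTE B (i := o)) ?o0 // oj mul0r !mulr0.
rewrite (UTE B (i := i)); last by move: lt; rewrite jo; lia.
rewrite jo (UTE B (leqnn o)).
by rewrite eqxx /=; ring.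
Qed.

(** Conjugation by [elem b o c] moves A, modulo depth k, by c times its entry
    (a, b) at the position (a, o), and nowhere else. When that entry is nonzero
    c can be chosen to produce any displacement; when it is zero the shear does
    not move A. *)
Lemma shear_conj phi A : phi 0 = 0 ->
  exists g, eq_depth k (shear phi A) (A ^ g)%g.
Proof.
move=> phi0; exists (elem b o (phi (A a b) / A a b)).
set c := _ / _; have cE : A a b * c = phi (A a b).
  by rewrite /c; have [->|nz] := eqVneq (A a b) 0; rewrite ?phi0 ?mul0r // mulrC divfK.
apply/(eq_depthMl _ (elem b o c)); rewrite -conjgC => i j lt.
rewrite mul_eleml // !shearE (mul_elemr A) //.
have [jo|nj] := eqVneq j o; last first.
  have oj : (o == j) = false by rewrite eq_sym (negPf nj).
  by rewrite (UTE A (i := o)) ?o0 // oj /=; ring.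
rewrite -cE; move: lt; rewrite jo o0 ak => lt.
rewrite (UTE A (leqnn o)) eqxx (UTE A (ltnW ltoa)) (_ : o == a = false); last by ord_neq.
have [ia|ni] := eqVneq i a.
  rewrite ia (UTE A (leqnn a)) eqxx (_ : a == b = false) /=; [by ring|by ord_neq].
have lt_ia : (i < a)%N by rewrite ltn_neqAle -ltnS; apply/andP.
rewrite (UTE A (ltnW lt_ia)) (UTE A (i := i) (j := b)); last by lia.
by rewrite (negPf ni) /=; ring.
Qed.

(** A single conjugating g moves [elem a b t] at (a, o) by t times its own
    entry (b, o), so the displacement phi t must be linear in t. *)
Lemma shear_not_conj phi g :
  (forall A, eq_depth k (shear phi A) (A ^ g)%g) -> forall t, phi t = t * phi 1.
Proof.
move=> sg.
suff phiE t : phi t = t * g b o by move=> t; rewrite (phiE t) (phiE 1) mul1r.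
have A_id : eq_depth a (elem a b t) (shear phi (elem a b t)).
  move=> i j lt; rewrite shearE; have [jo|nj] := eqVneq j o; last by rewrite mul0r addr0.
  rewrite (UTE _ (i := i) (j := a)); last by move: lt; rewrite jo; lia.
  have -> : (i == a) = false by move: lt; rewrite jo => lt; ord_neq.
  by rewrite /= mul0r mulr0 addr0.
have le : (a <= o + a)%N by lia.
have sg' : eq_depth a.+1 (shear phi (elem a b t)) (elem a b t ^ g)%g.
  by rewrite -ak.
have := deviation_conj A_id sg' le.
rewrite commutator_elem // shearE eqxx (UTE _ (leqnn a)) eqxx !elemE //.
have -> : (o == b) = false by ord_neq.
have -> : (a == b) = false by ord_neq.
by rewrite !eqxx /= add0r !mul1r addrAC subrr add0r mul0r subr0.
Qed.

End CentralShear.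

Lemma Autc_not_inner (K : fieldType) (n k : nat) : (3 <= k <= n)%N ->
  ~ prime_field K ->
  exists alpha, Autc (Gamma K n k) alpha /\ ~ Inn (Gamma K n k) alpha.
Proof.
case/andP=> k3 kn /nonprime_field_additive[phi [phiD [x phix]]].
have phi0 : phi 0 = 0 by have := phiD 0 0; rewrite addr0 -[LHS]addr0 => /addrI.
have k0 : (0 < k)%N by lia.
have [lta ltb lto] : [/\ (k.-1 < n), (k.-2 < n) & (0 < n)]%N by split; lia.
pose a := Ordinal lta; pose b := Ordinal ltb; pose o := Ordinal lto.
have [ak ab o0 b0] : [/\ k = a.+1, a = b.+1 :> nat, o = 0%N :> nat & (0 < b)%N].
  by split=> /=; lia.
pose alpha psi (u : Gamma K n k) := proj k (shear a b o psi (repr u)).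
have alphaE psi A : alpha psi (proj k A) = proj k (shear a b o psi A).
  apply/proj_eq => //; apply: shear_eq_depth => //.
  by apply/(proj_eq k0); rewrite /proj reprK.
have alphaK psi psi' : (forall t, psi' t = - psi t) -> cancel (alpha psi) (alpha psi').
  move=> psiE u; have [A <-] := proj_repr u.
  by rewrite !alphaE (shearK ak ab o0 b0 psiE).
exists (alpha phi); split; last first.
  move=> [u _ /esym au]; have [g gu] := proj_repr u.
  case/eqP: phix; apply: (shear_not_conj ak ab o0 b0 (g := g)) => // A.
  by apply/(proj_eq k0); rewrite -alphaE au projJ gu.
split; first split.
- by exists (alpha (fun t => - phi t)); apply: alphaK => // t; rewrite opprK.
- move=> u v; have [A <-] := proj_repr u; have [B <-] := proj_repr v.
  by rewrite -projM !alphaE -projM; apply/(proj_eq k0)/shearM.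
move=> u; have [A <-] := proj_repr u; have [g Ag] := shear_conj ak ab o0 b0 A phi0.
by exists (proj k g); rewrite alphaE -projJ; apply/(proj_eq k0).
Qed.

Close Scope ring_scope.

Theorem theoremA (K : fieldType) (n k : nat) (hn : 3 <= n) (hk : 3 <= k <= n) :
  Autc (Gamma K n k) = Inn (Gamma K n k) <-> prime_field K.
Proof.
split=> [AutcE|primeK].
  apply: contrapT => /(Autc_not_inner hk)[alpha [alphaA]].
  by rewrite -AutcE; apply.
apply/seteqP; split; last exact: Inn_sub_Autc.
by case: k hk => // d _; apply: Autc_inner.
Qed.
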